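(* Let $k\ge 3$ and let $K$ be a two-bridge link of Conway normal form $C(m_1,\dots,m_k)$, where $m_i>0$ for all $i$, $m_1\ge 2$ and $m_k\ge 2$. Then $K$ possesses a hard trigonal diagram.
   Context: Trigonal diagrams. For a finite (possibly empty) sequence of integers $m_1,\dots,m_k$ (zero allowed), $D(m_1,\dots,m_k)$ is the following diagram of a long link (Conway's open form, also called trigonal form). Take three horizontal strand positions $1,2,3$ across a vertical strip in the plane. At the left, position $1$ runs to infinity and positions $2,3$ are joined by a cap. Reading from left to right one inserts successively $|m_1|$ half-twists (crossings) on positions $1,2$, then $|m_2|$ half-twists on positions $2,3$, then $|m_3|$ on positions $1,2$, and so on, alternately. At the right, if $k$ is odd, position $1$ runs to infinity and positions $2,3$ are joined by a cap; if $k$ is even, position $3$ runs to infinity and positions $1,2$ are joined by a cap. Sign convention: for $i$ odd, $m_i>0$ means right-handed half-twists; for $i$ even, $m_i>0$ means left-handed half-twists. Thus a diagram whose $m_i$ all have the same sign is alternating. (Positions $1,2,3$ may be numbered from top to bottom or from bottom to top; the two resulting diagrams are exchanged by a half-turn of space about the horizontal axis and carry the same Conway notation.) Joining the two infinite ends gives an (unoriented) two-bridge link in the usual sense. A trigonal diagram is a diagram of this form. Conway's normal form. A link is of Conway's normal form $C(m_1,\dots,m_k)$, where the $m_i$ all have the same sign, if it admits the (alternating) diagram $D(m_1,\dots,m_k)$. Hard diagrams. A trigonal diagram is called hard if it is non-alternating and the only Reidemeister moves that can be applied to it are moves that increase the number of crossings (so no crossing-decreasing move of type I or II and no move of type III is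 applicable). *)

(* Defs.v *)
From Stdlib Require Import Relation_Operators.
From mathcomp Require Import all_boot all_order all_algebra.
Set Implicit Arguments.
Unset Strict Implicit.
Unset Printing Implicit Defensive.
Import Order.TTheory GRing.Theory Num.Theory.

(* Diagrams are cut into vertical slices, each containing one cup, cap or
   crossing, and read from left to right.  Between two slices the strands are
   numbered 0, 1, 2, ... from top to bottom.

   [Cup] opens to the right (two new strands appear), [Cap] joins two strands,
   and in [Cross s] the strand going from the upper position on the left to the
   lower position on the right passes over the other one iff [s] holds.  So
   [Cross true] is a right-handed half-twist: with both strands directed to the
   right it is a positive crossing. *)
Inductive kind := Cup | Cap | Cross of bool.

Definition ins (k : kind) : nat := if k is Cup then 0 else 2.
Definition outs (k : kind) : nat := if k is Cap then 0 else 2.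

(* [(k, i)] acts on the strands i, ..., i + ins k - 1 and replaces them by the
   strands i, ..., i + outs k - 1. *)
Definition slice : Type := kind * nat.

Fixpoint width (n : nat) (w : seq slice) : option nat :=
  if w is (k, i) :: w' then
    if i + ins k <= n then width (n - ins k + outs k) w' else None
  else Some n.

(* Planar diagrams with p ends on the left and q ends on the right: closed
   diagrams for p = q = 0, diagrams of long links for p = q = 1. *)
Record diagram (p q : nat) := Diagram {
  word :> seq slice;
  word_width : width p word == Some q
}.

Definition is_cross (x : slice) : bool := if x.1 is Cross _ then true else false.
Definition crossings p q (D : diagram p q) : nat := count is_cross D.

(* The moves which generate planar isotopy of sliced diagrams: exchange of two
   slices acting on disjoint sets of strands, cancellation of a maximum with a
   minimum, and rotation of a crossing past a cap or a cup. *)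
Inductive planar_rule : seq slice -> seq slice -> Prop :=
| planar_exchange g h i j : i <= j ->
    planar_rule [:: (g, i); (h, j + outs g)] [:: (h, j + ins g); (g, i)]
| planar_zigzag_up i : planar_rule [:: (Cup, i); (Cap, i.+1)] [::]
| planar_zigzag_down i : planar_rule [:: (Cup, i.+1); (Cap, i)] [::]
| planar_cap s i :
    planar_rule [:: (Cross s, i); (Cap, i.+1)] [:: (Cross (~~ s), i.+1); (Cap, i)]
| planar_cup s i :
    planar_rule [:: (Cup, i.+1); (Cross s, i)] [:: (Cup, i); (Cross (~~ s), i.+1)].

(* Reidemeister moves; all other positions of the same moves are obtained from
   these by planar isotopy.  In type III, for the strands x, y, z entering at
   i, i+1, i+2, the signs a, b, c say whether x is over y, x over z, y over z;
   the side condition excludes exactly the two cyclic cases. *)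
Inductive reidemeister_rule : seq slice -> seq slice -> Prop :=
| reidemeister1 s i :
    reidemeister_rule [:: (Cup, i); (Cross s, i)] [:: (Cup, i)]
| reidemeister2 s i :
    reidemeister_rule [:: (Cross s, i); (Cross (~~ s), i)] [::]
| reidemeister3 a b c i : (a == b) || (b == c) ->
    reidemeister_rule [:: (Cross a, i); (Cross b, i.+1); (Cross c, i)]
                      [:: (Cross c, i.+1); (Cross b, i); (Cross a, i.+1)].

(* Both sides being diagrams, the strands named by the rule exist. *)
Definition rewrites (rule : seq slice -> seq slice -> Prop) p q
    (D D' : diagram p q) : Prop :=
  exists l r u v, [/\ rule u v, word D = l ++ u ++ r & word D' = l ++ v ++ r].

Definition planar_isotopic p q : diagram p q -> diagram p q -> Prop :=
  @clos_refl_sym_trans (diagram p q) (@rewrites planar_rule p q).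

(* One Reidemeister move, in either direction, performed on the planar isotopy
   class of a diagram. *)
Definition reidemeister_move p q (D D' : diagram p q) : Prop :=
  exists E E', [/\ planar_isotopic D E,
    rewrites reidemeister_rule E E' \/ rewrites reidemeister_rule E' E
    & planar_isotopic E' D'].

Definition isotopic p q : diagram p q -> diagram p q -> Prop :=
  @clos_refl_sym_trans (diagram p q)
    (fun D D' => planar_isotopic D D' \/ reidemeister_move D D').

(* [(t, j)] is the point of strand j just before slice number t; [arc_step]
   follows the diagram through everything but the crossings. *)
Inductive arc_step (w : seq slice) : nat * nat -> nat * nat -> Prop :=
| arc_above t k i j : onth w t = Some (k, i) -> j < i ->
    arc_step w (t, j) (t.+1, j)
| arc_below t k i j : onth w t = Some (k, i) -> i <= j ->
    arc_step w (t, j + ins k) (t.+1, j + outs k)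
| arc_cup t i : onth w t = Some (Cup, i) -> arc_step w (t.+1, i) (t.+1, i.+1)
| arc_cap t i : onth w t = Some (Cap, i) -> arc_step w (t, i) (t, i.+1).

Definition same_arc (w : seq slice) : nat * nat -> nat * nat -> Prop :=
  @clos_refl_sym_trans (nat * nat)%type (arc_step w).

(* [crossing_end w (t, r, d) x o]: slice t is a crossing; among its four ends,
   the one on the right iff r and at the lower position iff d is at the point x
   and belongs to the over-strand iff o. *)
Inductive crossing_end (w : seq slice) :
    nat * bool * bool -> nat * nat -> bool -> Prop :=
| CrossingEnd t s i (r d : bool) : onth w t = Some (Cross s, i) ->
    crossing_end w (t, r, d) (t + r, i + d) (s == (r == d)).

(* Every arc between two consecutive passages through crossings leads from an
   over-passage to an under-passage. *)
Definition alternating p q (D : diagram p q) : Prop :=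
  forall e e' x x' o o',
    crossing_end D e x o -> crossing_end D e' x' o' ->
    e <> e' -> same_arc D x x' -> o <> o'.

Definition hard p q (D : diagram p q) : Prop :=
  ~ alternating D /\
  forall D' : diagram p q, reidemeister_move D D' -> crossings D < crossings D'.

Lemma width_cat n w w' : width n (w ++ w') = obind (width^~ w') (width n w).
Proof. by elim: w n => [|[k i] w IHw] n //=; case: ifP => // _; rewrite IHw. Qed.

Lemma width_add n n' m w : width n w = Some n' -> width (n + m) w = Some (n' + m).
Proof.
elim: w n => [|[k i] w IHw] n /=; first by case=> ->.
case: ifP => // le_n /IHw; rewrite (leq_trans le_n (leq_addr _ _)) => <-.
by rewrite -addnBAC ?(leq_trans (leq_addl _ _) le_n) // addnAC.
Qed.

Lemma closure_width (D : diagram 1 1) :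
  width 0 ((Cup, 0) :: word D ++ [:: (Cap, 0)]) == Some 0.
Proof.
by case: D => w /= /eqP /(@width_add _ _ 1) Dw; rewrite width_cat Dw.
Qed.

(* The two infinite ends are joined by an arc passing below the diagram. *)
Definition closure (D : diagram 1 1) : diagram 0 0 := Diagram (closure_width D).

Fixpoint twists (odd_index : bool) (m : seq int) : seq slice :=
  if m is x :: m' then
    nseq `|x|%N (Cross ((0 < x)%R == odd_index), if odd_index then 0 else 1)
      ++ twists (~~ odd_index) m'
  else [::].

Definition trigonal_word (m : seq int) : seq slice :=
  (Cup, 1) :: twists true m ++ [:: (Cap, if odd (size m) then 1 else 0)].

Lemma trigonal_width (m : seq int) : width 1 (trigonal_word m) == Some 1.
Proof.
have twist3 s i n w : i <= 1 ->
    width 3 (nseq n (Cross s, i) ++ w) = width 3 w.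
  by move=> le_i; elim: n => //= n IHn; rewrite (leq_add2r 2 i 1) le_i.
have tw3 b : width 3 (twists b m) = Some 3.
  by elim: m b => //= x m IHm b; rewrite twist3 //; case: b.
by rewrite /= width_cat tw3 /=; case: odd.
Qed.

(* D(m_1, ..., m_k) *)
Definition trigonal (m : seq int) : diagram 1 1 := Diagram (trigonal_width m).

(* A link is given by any of its closed diagrams. *)
Definition diagram_of_link (D : diagram 1 1) (K : diagram 0 0) : Prop :=
  isotopic (closure D) K.

Definition conway_normal_form (m : seq int) (K : diagram 0 0) : Prop :=
  (all (fun x : int => 0 < x)%R m || all (fun x : int => x < 0)%R m) /\
  diagram_of_link (trigonal m) K.

(* Main.v *)
From Stdlib Require Import Relation_Operators.
Require Import Defs.
From mathcomp Require Import all_boot all_order all_algebra.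
From mathcomp Require Import zify.
Set Implicit Arguments.
Unset Strict Implicit.
Unset Printing Implicit Defensive.
Import Order.TTheory GRing.Theory Num.Theory.

(** The hard diagram comes from the identity of continued fractions
      [.., a, b, c, ..] = [.., a + 1, -2, 2, -2, .., +-(c + 1), ..]
    with b - 1 entries +-2, applied to the first three entries of m; the
    entries after c keep their absolute values and take the sign of the entry
    c + 1.

    Isotopy.  Turning the right part of a diagram over, about the horizontal
    axis, exchanges the twists on the positions 1, 2 with those on the
    positions 2, 3 and costs a half twist of the three strands ([cap_flip]):
    a half twist slides through a braid by Reidemeister moves II and III, and a
    cap absorbs it by one move I and one move II.  Each crossing of the twist b
    is cancelled by such a half twist, which leaves two crossings behind, one
    for each of two consecutive new entries ([turn_isotopic]).

    Hardness.  Colour some regions of a diagram, leaving the unbounded ones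
    blank, and count the coloured corners at the crossings.  The two vertical
    angles swept when the over-strand turns counterclockwise to the
    under-strand are of one type, the other two of the other type; both counts
    are invariant under planar isotopy ([planar_isotopic_colouring]).  Along an
    edge between two crossings the strand passes from over to under exactly
    when the corners of an adjacent face at its two ends have the same type.
    So in a diagram to which a non-increasing Reidemeister move applies one
    can colour a monogon, a bigon with one corner of each type, or a triangle
    with corners of both types ([reidemeister_colouring]).  In the diagram
    above, a bounded face with corners of both types has at least four corners,
    and every other one has at least two; the counts that this allows for unions of
    faces ([tame]) exclude those moves ([trigonal_rigid]).  Finally the sign
    change after the entry a + 1 makes the diagram non-alternating. *)

(** * Colourings of the regions *)

(** A colouring of the regions is followed through the slices: between two
    slices, region j lies just above strand j, and the value at j of a function
    says whether it is coloured.  Regions are numbered without regard to the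
    number of strands, so that the blank ones outside a diagram extend beyond
    its last strand. *)
Definition step (x : slice) (c c' : nat -> bool) : Prop :=
  (forall j, j <= x.2 -> c' j = c j) /\
  (forall j, c' (x.2 + outs x.1 + j) = c (x.2 + ins x.1 + j)).

(** Rotating a crossing by a quarter turn exchanges its left and right corners
    with its top and bottom ones and changes its sign, so the type of a corner
    is intrinsic. *)
Definition corners (x : slice) (c c' : nat -> bool) (t : bool) : nat :=
  if x is (Cross s, i) then
    if t == s then c i.+1 + c' i.+1 else c i + c i.+2
  else 0.

Fixpoint colouring (w : seq slice) (c c' : nat -> bool) (p : bool -> nat) :
    Prop :=
  if w is x :: w' then
    exists c1 p1, [/\ step x c c1, colouring w' c1 c' p1
                    & forall t, p t = corners x c c1 t + p1 t]
  else c' =1 c /\ p =1 (fun=> 0).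

Lemma colouring_ext w c d c' d' p q :
  c =1 d -> c' =1 d' -> p =1 q -> colouring w c c' p -> colouring w d d' q.
Proof.
elim: w c d p q => [|x w IH] c d p q cd cd' pq /=.
  by case=> h1 h2; split=> j; rewrite -?cd' -?pq ?h1 ?h2 ?cd.
case=> c1 [p1 [[h1 h1'] h2 h3]]; exists c1, p1; split.
- by split=> j => [hj|]; rewrite -cd; [apply: h1 | apply: h1'].
- exact: IH h2.
- move=> t; rewrite -pq h3; congr (_ + _).
  by case: (x) => [[||s] i] //=; rewrite !cd.
Qed.

Lemma colouring_cat w1 w2 c c' p :
  colouring (w1 ++ w2) c c' p <->
  exists c1 p1 p2, [/\ colouring w1 c c1 p1, colouring w2 c1 c' p2
                     & forall t, p t = p1 t + p2 t].
Proof.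
elim: w1 c p => [|x w1 IH] c p /=; split.
- by move=> h; exists c, (fun=> 0), p.
- case=> c1 [p1 [p2 [[h1 h1'] h2 h3]]].
  by apply: colouring_ext h2 => // t; rewrite h3 h1'.
- case=> d [p1 [h1 /IH[c1 [p2 [p3 [h2 h3 h4]]]] h5]].
  exists c1, (fun t => corners x c d t + p2 t), p3; split=> // [|t].
    by exists d, p2.
  by rewrite h5 h4 addnA.
- case=> c1 [p1 [p2 [[d [p3 [h1 h2 h3]]] h4 h5]]].
  exists d, (fun t => p3 t + p2 t); split=> // [|t].
    by apply/IH; exists c1, p3, p2.
  by rewrite h5 h3 addnA.
Qed.

Lemma step_low x c c' j : step x c c' -> j <= x.2 -> c' j = c j.
Proof. by case=> h _; apply: h. Qed.

Lemma step_high x c c' j l :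
  step x c c' -> x.2 + outs x.1 <= j -> j + ins x.1 = l + outs x.1 ->
  c' j = c l.
Proof.
case=> _ h hj e.
have -> : j = x.2 + outs x.1 + (j - (x.2 + outs x.1)) by lia.
by rewrite h; congr (c _); lia.
Qed.

Lemma corners_shift k i i' c c' d d' :
  (forall e, e <= ins k -> c (i + e) = d (i' + e)) ->
  (0 < outs k -> c' i.+1 = d' i'.+1) ->
  corners (k, i) c c' =1 corners (k, i') d d'.
Proof.
case: k => [||s] //= h1 h2 t /=.
have := h1 0; have := h1 1; have := h1 2; rewrite !addn0 !addn1 !addn2.
by move=> /= -> // -> // -> //; rewrite h2.
Qed.

Lemma colouring2 x y c c' p :
  colouring [:: x; y] c c' p <->
  exists d, [/\ step x c d, step y d c'
              & forall t, p t = corners x c d t + corners y d c' t].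
Proof.
split=> [[d [p1 [h1 [e [p2 [h2 [h3 h4] h5]]]] h6]]|[d [h1 h2 h3]]].
  have {h2} h2 : step y d c' by case: h2 => h2 h2'; split=> j *; rewrite h3; auto.
  exists d; split=> // t; rewrite h6 h5 h4 addn0; congr (_ + _).
  by case: (y) => [[||s] i] //=; rewrite !h3.
exists d, (corners y d c'); split=> //; exists c', (fun=> 0).
by split=> // t; rewrite addn0.
Qed.

(** Reading a word from right to left, the signs of the crossings being kept,
    preserves the counts of corners; this halves the number of planar rules to
    examine. *)
Definition reflect_slice (x : slice) : slice :=
  (match x.1 with Cup => Cap | Cap => Cup | Cross s => Cross s end, x.2).

Lemma reflect_sliceK : involutive reflect_slice.
Proof. by case=> [[||s] i]. Qed.

Lemma step_reflect x c c' : step x c c' -> step (reflect_slice x) c' c.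
Proof.
case: x => k i [h1 h2]; split=> j => [hj|]; first by rewrite h1.
by have := h2 j; case: (k) => [||s] /= ->.
Qed.

Lemma corners_reflect x c c' :
  step x c c' -> corners (reflect_slice x) c' c =1 corners x c c'.
Proof.
case: x => [[||s] i] [/= h1 h2] t //; rewrite /reflect_slice /=; have := h2 0.
by rewrite !addn0 addn2 (h1 i) // [c' i.+1 + _]addnC => ->.
Qed.

Lemma colouring_reflect w c c' p :
  colouring w c c' p -> colouring (rev (map reflect_slice w)) c' c p.
Proof.
elim: w c p => [|x w IH] c p /=; first by case=> h1 h2; split=> // j; rewrite h1.
case=> d [p1 [h1 h2 h3]]; rewrite rev_cons -cats1; apply/colouring_cat.
exists d, p1, (corners x c d); split; first exact: IH.
  exists c, (fun=> 0); split=> // [|t]; first exact: step_reflect.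
  by rewrite addn0 corners_reflect.
by move=> t; rewrite h3 addnC.
Qed.

(** The new intermediate colouring agrees with the first one down to the lower
    slice, and below it with the shifted last one. *)
Lemma colouring_exchange g h i j c c' p : i <= j ->
  colouring [:: (g, i); (h, j + outs g)] c c' p ->
  colouring [:: (h, j + ins g); (g, i)] c c' p.
Proof.
move=> le_ij /colouring2[c1 [s1 s2 hp]]; apply/colouring2.
pose d x := if x <= j + ins g then c x else c' (x + outs g - ins g).
exists d; split.
- split=> /= x => [le_x|]; first by rewrite /d le_x.
  rewrite /d; case: leqP => lt_x.
    rewrite -(step_high (j := j + outs g) s1) //=; try lia.
    rewrite -(step_low s2) //=.
    rewrite (step_high (l := j + outs g + ins h + x) s2) //=; try lia.
    by rewrite (step_high (l := j + ins g + ins h + x) s1) //=; try lia; congr (_ _); lia.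
  rewrite (step_high (l := j + outs g + ins h + x) s2) //=; try lia.
  by rewrite (step_high (l := j + ins g + ins h + x) s1) //=; lia.
- split=> /= x => [le_x|].
    rewrite (step_low s2) /=; last lia.
    by rewrite (step_low s1) //= /d ifT //; lia.
  rewrite /d; case: leqP => hx; last by congr (_ _); lia.
  rewrite (step_low s2) /=; last lia.
  by rewrite (step_high (l := i + ins g + x) s1) //=; lia.
move=> t; rewrite hp addnC; congr (_ + _).
  apply: corners_shift => [e he|lt0].
    by rewrite (step_high (l := j + ins g + e) s1) //=; lia.
  by rewrite /d ifF; [congr (_ _); lia | lia].
apply: corners_shift => [e he|lt0]; first by rewrite /d ifT //; lia.
by rewrite (step_low s2) //=; case: (g) lt0 => //=; lia.
Qed.

Definition blank : nat -> bool := fun=> false.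

(** A planar rule deforms the regions without changing at which crossings they
    have corners, and a quarter turn of a crossing preserves the types. *)
Lemma colouring_planar u v c c' p :
  planar_rule u v -> colouring u c c' p <-> colouring v c c' p.
Proof.
(* The other zigzag and the rotation past a cup follow by reflection. *)
have zig i d d' q :
    colouring [:: (Cup, i); (Cap, i.+1)] d d' q <-> colouring [::] d d' q.
  split=> [/colouring2[e [s1 s2 hq]]|[h1 h2]].
    split=> j; last by rewrite hq.
    case: (leqP j i) => hj; first by rewrite (step_low s2) ?(step_low s1) //=; lia.
    by rewrite (step_high (l := j.+2) s2) ?(step_high (l := j) s1) //=; lia.
  apply/colouring2; exists (fun x : nat => if x <= i.+1 then d x else d (x - 2)).
  split=> //=; split=> j /=.
  - by move=> hj; rewrite ifT //; lia.
  - by case: leqP => hj; congr (_ _); lia.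
  - by move=> hj; rewrite hj h1.
  - by rewrite ifF; [rewrite h1; congr (_ _); lia | lia].
have negb_eq (t s : bool) : (t == ~~ s) = ~~ (t == s) by case: t; case: s.
have turn s i d d' q : colouring [:: (Cross s, i); (Cap, i.+1)] d d' q <->
    colouring [:: (Cross (~~ s), i.+1); (Cap, i)] d d' q.
  split=> /colouring2[e [s1 s2 hq]]; apply/colouring2.
    (* The cap joins the region on the right of the crossing to the lowest
       one. *)
    have e1 : d' i.+1 = e i.+1 by rewrite (step_low s2).
    have e2 : e i.+1 = d i.+3.
      by rewrite -e1 (step_high (l := i.+3) s2) ?(step_high (l := i.+3) s1) //=; lia.
    exists (fun x : nat => if x == i.+2 then d i else d x); split.
    + split=> j /= => [hj|]; first by rewrite ifF //; lia.
      by rewrite ifF //; lia.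
    + split=> j /=.
        move=> hj; rewrite ifF; last lia.
        by rewrite (step_low s2) ?(step_low s1) //=; lia.
      case: eqP => hj.
        have -> : i + 0 + j = i by lia.
        by rewrite (step_low s2) ?(step_low s1) //=; lia.
      rewrite (step_high (l := i + j + 2) s2) /=; try lia.
      by rewrite (step_high (l := i + j + 2) s1) /=; try lia; congr (_ _); lia.
    + move=> t; rewrite hq /= eqxx e2 !addn0.
      by rewrite negb_eq; case: (t == s) => /=; lia.
  have e1 : d' i = e i.+2 by rewrite (step_high (l := i.+2) s2) //=; lia.
  have e2 : e i.+2 = d i.
    by rewrite -e1 (step_low s2) // (step_low s1) //=.
  exists (fun x : nat => if x == i.+1 then d i.+3 else d x); split.
  - split=> j /= => [hj|]; first by rewrite ifF //; lia.
    by rewrite ifF //; lia.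
  - split=> j /=.
      move=> hj; case: eqP => [->|ne_j].
        by rewrite (step_high (l := i.+3) s2) ?(step_high (l := i.+3) s1) //=; lia.
      by rewrite (step_low s2) ?(step_low s1) //=; lia.
    rewrite ifF; last lia.
    rewrite (step_high (l := i + j + 3) s2) /=; try lia.
    by rewrite (step_high (l := i + j + 3) s1) /=; try lia; congr (_ _); lia.
  move=> t; rewrite hq /= eqxx e2 !addn0.
  by rewrite negb_eq; case: (t == s) => /=; lia.
have refl (w w' : seq slice) :
    (forall d d' q, colouring w d d' q -> colouring w' d d' q) ->
    forall d d' q, colouring (rev (map reflect_slice w)) d d' q ->
                   colouring (rev (map reflect_slice w')) d d' q.
  move=> h d d' q /colouring_reflect; rewrite map_rev revK (mapK reflect_sliceK).
  by move=> /h /colouring_reflect.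
case=> {u v} [g h i j le_ij|i|i|s i|s i].
- split; first exact: colouring_exchange.
  have outs_ins k : outs (reflect_slice (k, 0)).1 = ins k by case: k.
  have ins_outs k : ins (reflect_slice (k, 0)).1 = outs k by case: k.
  have := @refl _ _ (fun d d' q =>
    @colouring_exchange (reflect_slice (g, 0)).1 (reflect_slice (h, 0)).1
      i j d d' q le_ij).
  by rewrite outs_ins ins_outs; case: (g); case: (h) => /= *; auto.
- exact: zig.
- split; [apply: (refl [:: (Cup, i); (Cap, i.+1)] [::])
         | apply: (refl [::] [:: (Cup, i); (Cap, i.+1)])].
    by move=> d d' q /zig.
  by move=> d d' q /zig.
- exact: turn.
- split; [apply: (refl [:: (Cross s, i); (Cap, i.+1)]
                       [:: (Cross (~~ s), i.+1); (Cap, i)])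
         | apply: (refl [:: (Cross (~~ s), i.+1); (Cap, i)]
                        [:: (Cross s, i); (Cap, i.+1)])].
    by move=> d d' q /turn.
  by move=> d d' q /turn.
Qed.

(** * Diagrams without non-increasing moves *)

(** The numbers of corners of the two types in a union of faces each of which
    has at least four corners, or at least two corners all of one type.  The
    values excluded are (1,0), (1,1), (2,1) up to order: the monogons, the
    bigons of a move II and the triangles of a move III. *)
Definition tame (p : bool -> nat) : bool :=
  [|| 3 < p true + p false, (p true == 0) && (p false != 1)
    | (p false == 0) && (p true != 1)].

Lemma tame_ext p q : p =1 q -> tame p = tame q.
Proof. by move=> pq; rewrite /tame !pq. Qed.

Lemma tame_add p q : tame p -> tame q -> tame (fun t => p t + q t).
Proof. by rewrite /tame; lia. Qed.

Lemma tame_reindex b p : tame (fun t => p (t == b)) = tame p.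
Proof.
case: b; first by apply: tame_ext; case.
rewrite (tame_ext (q := fun t => p (~~ t))) /tame /=; first lia.
by case.
Qed.

Lemma tame_double b m : tame (fun t => (t == b) * m.*2).
Proof.
rewrite (tame_reindex b (fun e : bool => e * m.*2)) /tame mul1n mul0n.
by rewrite eqxx /=; lia.
Qed.

Definition rigid p q (D : diagram p q) : Prop :=
  forall w, colouring D blank blank w -> tame w.

Lemma planar_isotopic_colouring p q (D E : diagram p q) : planar_isotopic D E ->
  (forall c c' w, colouring D c c' w <-> colouring E c c' w) /\
  crossings D = crossings E.
Proof.
elim=> {D E} [D E [l [r [u [v [uv Dw Ew]]]]]|D|D E _ [h1 h2]
             |D E F _ [h1 h2] _ [h3 h4]].
- split; last first.
    rewrite /crossings Dw Ew !count_cat; congr (_ + (_ + _)).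
    by case: uv => [g h i j _|i|i|s i|s i]; rewrite //= addn0 addn0 addnC.
  move=> c c' w; rewrite Dw Ew !colouring_cat.
  by split=> -[d [p1 [p2 [h1 /colouring_cat[e [p3 [p4 [h2 h3 h4]]]] h5]]]];
    exists d, p1, p2; split=> //; apply/colouring_cat; exists e, p3, p4; split=> //;
    apply/(colouring_planar _ _ _ uv).
- by [].
- by split=> // c c' w; rewrite h1.
- by split=> [c c' w|]; rewrite ?h1 ?h2.
Qed.

Lemma colouring_blank w : colouring w blank blank (fun=> 0).
Proof.
elim: w => [|x w IH] //=; exists blank, (fun=> 0); split=> // t.
by case: x => [[||s] i] //=; case: ifP.
Qed.

(** The region enclosed by the crossings of the rule is coloured.  For move I
    it has one corner; for move II its two corners have opposite types, as one
    strand is over twice; for move III the types are a, ~~ b, c, which are equal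
    exactly for the two cyclic triangles. *)
Lemma reidemeister_colouring u v : reidemeister_rule u v ->
  (exists2 w, colouring u blank blank w & ~~ tame w) /\
  (count is_cross u <= count is_cross v ->
   exists2 w, colouring v blank blank w & ~~ tame w).
Proof.
(* [one i] colours only the region between the strands i and i.+1. *)
pose one i := fun j : nat => j == i.+1.
have off i : ((one i i = false) * (one i i.+2 = false) * (one i i.+3 = false) *
              (one i.+1 i = false) * (one i i.+1 = true))%type.
  by rewrite /one eqxx; do !split; apply/eqP; lia.
have cup i : step (Cup, i) blank (one i).
  by split=> j /=; rewrite /one /blank => *; apply/eqP; lia.
have opn s i : step (Cross s, i) blank (one i).
  by split=> j /=; rewrite /one /blank => *; apply/eqP; lia.
have cls s i : step (Cross s, i) (one i) blank.
  by split=> j /=; rewrite /one /blank => *; apply/esym/eqP; lia.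
case=> [s i|s i|a b c i abc].
- split=> //.
  exists (fun t => t == s); last by case: s.
  apply/colouring2; exists (one i); split=> // t; rewrite /= !off /blank.
  by case: eqP.
- split=> //.
  exists (fun=> 1) => //.
  apply/colouring2; exists (one i); split=> // t; rewrite /= !off /blank.
  by case: t; case: s.
split=> [|_].
  exists (fun t => (t == a) + (t == ~~ b) + (t == c)); last first.
    by case: a b c abc => [] [] [].
  exists (one i), (fun t => (t == ~~ b) + (t == c) : nat); split=> // [|t].
    apply/colouring2; exists (one i); split=> // t.
    by rewrite /= !off /blank; case: t b c abc => [] [] [].
  by rewrite /= !off -addnA; case: eqP.
exists (fun t => (t == c) + (t == ~~ b) + (t == a)); last first.
  by case: a b c abc => [] [] [].
exists (one i.+1), (fun t => (t == ~~ b) + (t == a) : nat); split=> // [|t].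
  apply/colouring2; exists (one i.+1); split=> // t.
  by rewrite /= !off /blank; case: t b a abc => [] [] [].
by rewrite /= !off -addnA; case: eqP.
Qed.

(** A move that does not create crossings starts at an end of a rule which has
    a colouring that is not tame; by planar invariance D would have one too. *)
Lemma rigid_move p q (D D' : diagram p q) :
  rigid D -> reidemeister_move D D' -> crossings D < crossings D'.
Proof.
move=> rD [E [E' [/planar_isotopic_colouring[DE ->] EE'
                   /planar_isotopic_colouring[_ <-]]]].
have bad l u r : word E = l ++ u ++ r ->
    (exists2 w, colouring u blank blank w & ~~ tame w) -> False.
  move=> Ew [w hw /negP[]]; apply: rD; apply/DE; rewrite Ew.
  apply/colouring_cat; exists blank, (fun=> 0), w; split=> //.
    exact: colouring_blank.
  apply/colouring_cat; exists blank, w, (fun=> 0); split=> //.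
    exact: colouring_blank.
  by move=> t; rewrite addn0.
case: EE' => -[l [r [u [v [/reidemeister_colouring[h1 h2] Ew Ew']]]]].
  by case: (bad _ _ _ Ew h1).
rewrite /crossings Ew Ew' !count_cat ltn_add2l ltn_add2r ltnNge.
by apply/negP => /h2; apply: bad Ew'.
Qed.

(** * Faces of trigonal diagrams *)

Definition nonzero (n : seq int) : bool := all (fun x => x != 0%R) n.

(** A corner of type t is counted at e = t in the upper inner region and at
    e = ~~ t in the lower one; with this convention every corner at the twist x
    is counted at the sign of x.  At the left of the first twist, the inner
    region between its two strands is closed by its first crossing, where it
    receives the corner counted by [head_corner]; the other inner region runs
    along the whole twist and is closed by the next one, whence [head_face]. *)
Definition head_corner (n : seq int) (e : bool) : nat :=
  if n is x :: _ then e == (0 < x)%R else 0.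

Definition head_face (n : seq int) (e : bool) : nat :=
  if n is x :: n' then `|x|%N * (e == (0 < x)%R) + head_corner n' e else 0.

(** The face opened by the last crossing of the twist x runs along the next
    twist; there is no such face after the last twist. *)
Fixpoint tame_faces (n : seq int) : bool :=
  if n is x :: n' then
    (nilp n' || tame (fun e => (e == (0 < x)%R) + head_face n' e)) && tame_faces n'
  else true.

(** The m coloured regions between two consecutive crossings are bigons with
    both corners of the same type. *)
Lemma colouring_nseq k s i c c' w :
  colouring (nseq k.+1 (Cross s, i)) c c' w ->
  (forall j : nat, j != i.+1 -> c' j = c j) /\
  exists m, forall t, w t = if t == s then c i.+1 + c' i.+1 + m.*2
                            else k.+1 * (c i + c i.+2).
Proof.
have stp d d' (j : nat) : step (Cross s, i) d d' -> j != i.+1 -> d' j = d j.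
  move=> st hj; case: (leqP j i) => h; first by rewrite (step_low st).
  by rewrite (step_high (l := j) st) //=; lia.
elim: k c w => [|k IH] c w [d [p [h1 h2 h3]]].
  case: h2 => h2 h4; split=> [j hj|]; first by rewrite h2 (stp _ _ _ h1).
  by exists 0 => t; rewrite h3 h4 h2 /= mul1n !addn0.
have [h4 [m h5]] := IH _ _ h2.
split=> [j hj|]; first by rewrite h4 // (stp _ _ _ h1).
exists (m + d i.+1) => t.
rewrite h3 h5 /= (stp _ _ i h1) ?(stp _ _ i.+2 h1) //; try lia.
by case: ifP => _; lia.
Qed.

(** Induction on the twists: each coloured region is counted when it is opened,
    the corners it receives later being given by [head_corner] and
    [head_face].  The region changed by the last twist opens into an unbounded
    region at the cap, hence is blank. *)
Lemma colouring_twists b n c c' w :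
  nonzero n -> tame_faces n ->
  colouring (twists b n ++ [:: (Cap, (odd (size n) == b) : nat)]) c c' w ->
  c 0 = false -> c 3 = false ->
  (nilp n -> c (1 + b) = false) /\
  exists2 g, tame g & forall t,
    w t = g t + c (1 + ~~ b) * head_corner n (t == b)
              + c (1 + b) * head_face n (t == ~~ b).
Proof.
elim: n b c w => [|x n IH] b c w.
  move=> _ _ /= [d [p [[h1 h2] [_ h3] h4]]] c0 c3; split.
    by move=> _; case: b h1 h2 => /= h1 h2; [rewrite -(h2 0) h1 | rewrite -h1 // (h2 0)].
  by exists (fun=> 0) => // t; rewrite h4 h3 !muln0.
move=> /= /andP[x0 n0] /andP[tx tn]; rewrite -catA => /colouring_cat.
case=> d [p1 [p2 [h1 h2 h3]]] c0 c3.
set s := ((0 < x)%R == b) in h1.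
have [k ek] : exists k, `|x|%N = k.+1 by exists `|x|.-1; lia.
have {h1} [h1 [m h4]] : (forall j : nat, j != (1 + ~~ b) -> d j = c j) /\
   exists m, forall t, p1 t = if t == s then c (1 + ~~ b) + d (1 + ~~ b) + m.*2
                              else `|x| * c (1 + b).
  move: h1; clear h2; rewrite ek; case: b @s => s;
    move=> /colouring_nseq[h1 [m h4]]; split=> //;
   by exists m => t; rewrite h4 ?c0 ?c3 ?addn0.
have e : (~~ odd (size n) == b) = (odd (size n) == ~~ b).
  by case: (odd _) (b) => [] [].
rewrite {}e in h2.
(* The region opened by this twist plays the other role in the next one. *)
have [||dn [g tg hg]] := IH _ _ _ n0 tn h2.
- by rewrite h1 //; case: (b).
- by rewrite h1 //; case: (b).
split=> //.
have eq_s t : (t == s) = ((t == b) == (0 < x)%R).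
  by rewrite /s; case: t (0 < x)%R (b) => [] [] [].
exists (fun t => g t + ((t == s) * m.*2 +
     d (1 + ~~ b) * ((t == s) + head_face n (t == b)))).
  apply: tame_add => //; apply: tame_add; first exact: tame_double.
  case/orP: tx => [/dn -> //|]; rewrite -(tame_reindex b); case: (d _) => //.
  by congr is_true; apply: tame_ext => t; rewrite mul1n eq_s.
move=> t; rewrite h3 hg h4 negbK [d (1 + b)]h1; last by case: (b).
have -> : ((t == ~~ b) == (0 < x)%R) = ~~ (t == s).
  by rewrite eq_s; case: (t) (0 < x)%R (b) => [] [] [].
rewrite -eq_s; case: (t == s) => /=; rewrite !mulnDr ?muln1 ?muln0 ?mul1n ?mul0n.
  by move: (c (1 + b) * _) (d _ * head_face _ _); clear; lia.
rewrite [`|x| * _]mulnC.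
move: (c (1 + b) * `|x|) (c (1 + b) * head_corner _ _) (d _ * head_face _ _).
by clear; lia.
Qed.

Lemma nonzero_opp n : nonzero (map (@GRing.opp int) n) = nonzero n.
Proof. by rewrite /nonzero all_map; apply: eq_all => x /=; rewrite oppr_eq0. Qed.

(** The hypothesis on [head_face] is for the face enclosed by the cup on the
    left, which precedes all the faces of [tame_faces]. *)
Lemma trigonal_rigid (n : seq int) :
  nonzero n -> tame_faces n -> tame (head_face n) ->
  rigid (trigonal n).
Proof.
move=> n0 tn tf w /= [c [p [cup]]].
have -> : (if odd (size n) then 1 else 0) = (odd (size n) == true) :> nat.
  by case: odd.
move=> /(colouring_twists n0 tn)[||_ [g tg hp] hw].
- exact: (step_low cup).
- by rewrite (step_high (l := 1) cup).
rewrite (tame_ext (q := fun t => g t + c 2 * head_face n (t == false))).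
  apply: tame_add tg _; case: (c 2) => //.
  rewrite -(tame_reindex false) in tf; congr is_true: tf.
  by apply: tame_ext => t; rewrite mul1n.
by move=> t; rewrite hw hp /= (step_low cup) //= addn0.
Qed.

Lemma head_face_opp (n : seq int) e : nonzero n ->
  head_face (map (@GRing.opp int) n) e = head_face n (~~ e)
  /\ head_corner (map (@GRing.opp int) n) e = head_corner n (~~ e).
Proof.
have sg (x : int) : x != 0%R -> (e == (0 < - x)%R) = (~~ e == (0 < x)%R).
  move=> hx; have -> : (0 < - x)%R = ~~ (0 < x)%R by lia.
  by case: e (0 < x)%R => [] [].
case: n => [|x [|y n]] //=; first by rewrite andbT => hx; rewrite sg // abszN.
by case/and3P => hx hy _; rewrite !sg // abszN.
Qed.

Lemma tame_faces_opp (n : seq int) : nonzero n ->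
  tame_faces (map (@GRing.opp int) n) = tame_faces n.
Proof.
elim: n => [|x n IH] //= /andP[hx hn]; rewrite IH //; congr (_ && _).
rewrite /nilp size_map; congr (_ || _).
rewrite -[RHS](tame_reindex false); apply: tame_ext => e.
have [-> _] := head_face_opp e hn.
have -> : (0 < - x)%R = ~~ (0 < x)%R by lia.
by case: e (0 < x)%R => [] [].
Qed.

(** In an alternating diagram each face has corners of one type only. *)
Lemma tame_faces_pos (n : seq int) : all (fun x => 0 < x)%R n -> tame_faces n.
Proof.
elim: n => [|x n IH] //= /andP[hx hn]; rewrite IH // andbT.
case: n hn {IH} => [|y n] //= /andP[hy hn]; rewrite hx hy /tame /=.
have -> : head_corner n false = 0 by case: n hn => //= z n /andP[->].
by rewrite muln0 muln1 /= orbC add1n eqSS addn_eq0 absz_eq0 gt_eqF.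
Qed.

(** * The replacement sequence *)

(** Up to signs, j twos followed by l; put after a positive entry, it has a sign
    change before each two and before l. *)
Fixpoint turn (j : nat) (l : seq int) : seq int :=
  map (@GRing.opp int) (if j is j'.+1 then Posz 2 :: turn j' l else l).

Definition face_size n := head_face n true + head_face n false.

Lemma turn_neq0 j l : nonzero l -> nonzero (turn j l).
Proof.
move=> hl; by elim: j => [|j IH]; rewrite nonzero_opp.
Qed.

Lemma face_size_cons (x : int) n : nonzero n ->
  face_size (x :: n) = `|x| + ~~ nilp n.
Proof.
rewrite /face_size /=; case: n => [|y n] /=; case: (0 < x)%R => /=; lia.
Qed.

(** The signs do not matter for a face with four corners, and the face along an
    entry preceded by a sign change has three corners besides the one at the
    previous entry: two at an entry 2 and one at the next entry, or those
    counted by [face_size l]. *)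
Lemma tame_turn j l : nonzero l -> tame_faces l ->
  3 <= face_size l -> tame_faces (turn j l) /\ 3 <= face_size (turn j l).
Proof.
move=> hl tl fl; have opp n : nonzero n ->
    face_size (map (@GRing.opp int) n) = face_size n.
  by move=> hn; rewrite /face_size !(head_face_opp _ hn).1 addnC.
elim: j => [|j [IH1 IH2]]; first by rewrite /= tame_faces_opp // opp.
have hj := turn_neq0 j hl.
have h2 : nonzero (Posz 2 :: turn j l) by [].
rewrite [turn _ _]/= -/(map (@GRing.opp int) (Posz 2 :: turn j l)).
rewrite tame_faces_opp // opp //.
rewrite face_size_cons //= IH1 andbT; split.
  apply/orP; right; rewrite /tame; move: IH2; rewrite /face_size /=; lia.
by case: (turn j l) IH2.
Qed.

(** The arc from the lower right end of the first crossing to the upper left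
    end of the second one is over at both ends, or under at both ends. *)
Lemma not_alternating p q (D : diagram p q) l r s :
  word D = l ++ [:: (Cross s, 0); (Cross s, 1)] ++ r -> ~ alternating D.
Proof.
move=> Dw alt.
have o1 : onth (word D) (size l) = Some (Cross s, 0).
  by rewrite Dw onth_cat ltnn subnn.
have o2 : onth (word D) (size l).+1 = Some (Cross s, 1).
  by rewrite Dw onth_cat ltnNge leqnSn /= subSnn.
apply: (alt _ _ _ _ _ _ (CrossingEnd true true o1)
          (CrossingEnd false false o2) _ _ (erefl _)) => //.
have -> : size l + true = (size l).+1 + false by rewrite addn1 addn0.
exact: rst_refl.
Qed.

(** * Isotopy of words *)

Inductive word_step p q (w w' : seq slice) : Prop :=
  WordStep l r u v of planar_rule u v \/ reidemeister_rule u v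
    & w = l ++ u ++ r & w' = l ++ v ++ r
    & width p w = Some q & width p w' = Some q.

Definition word_isotopic p q : seq slice -> seq slice -> Prop :=
  @clos_refl_sym_trans (seq slice) (word_step p q).

Lemma word_isotopic_width p q w w' : word_isotopic p q w w' ->
  width p w = Some q <-> width p w' = Some q.
Proof.
elim=> {w w'} [w w' [] //|//|w w' _ <- //|w w' w'' _ -> _ -> //].
Qed.

Lemma word_isotopicP p q (D D' : diagram p q) :
  word_isotopic p q D D' -> isotopic D D'.
Proof.
have [w Dw] : exists w, w = word D by exists (word D).
have [w' Dw'] : exists w', w' = word D' by exists (word D').
rewrite -Dw -Dw' => h; elim: h D D' Dw Dw' => {w w'}.
- move=> w w' [l r u v uv -> -> _ _] D D' Dw Dw'; apply: rst_step.
  case: uv => uv; [left|right].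
    by apply: rst_step; exists l, r, u, v.
  exists D, D'; split; [exact: rst_refl| |exact: rst_refl].
  by left; exists l, r, u, v.
- move=> w [w1 h1] [w2 h2] /= -> e; subst w2.
  by rewrite (eq_irrelevance h1 h2); apply: rst_refl.
- by move=> w w' _ IH D D' Dw Dw'; apply: rst_sym; apply: IH.
move=> w1 w2 w3 h12 IH1 _ IH2 D D' Dw Dw'.
have /eqP h2 : width p w2 = Some q.
  by apply/(word_isotopic_width h12); rewrite Dw; apply/eqP; case: (D).
apply: (rst_trans _ _ _ (Diagram h2)); [exact: IH1 | exact: IH2].
Qed.

Lemma word_isotopic_context p q p0 q0 l r w w' :
  width p0 l = Some p -> width q r = Some q0 ->
  word_isotopic p q w w' -> word_isotopic p0 q0 (l ++ w ++ r) (l ++ w' ++ r).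
Proof.
move=> hl hr.
have ctx x : width p x = Some q -> width p0 (l ++ x ++ r) = Some q0.
  by move=> hx; rewrite width_cat hl /= width_cat hx.
elim=> {w w'} [w w' [l' r' u v uv ew ew' h1 h2]|w|w w' _|w1 w2 w3 _ h1 _].
- by apply: rst_step; exists (l ++ l') (r' ++ r) u v; rewrite ?ctx // ?ew ?ew' !catA.
- exact: rst_refl.
- exact: rst_sym.
exact: rst_trans h1.
Qed.

Lemma word_isotopic_rule p q l r u v : planar_rule u v \/ reidemeister_rule u v ->
  width p (l ++ u ++ r) = Some q -> width p (l ++ v ++ r) = Some q ->
  word_isotopic p q (l ++ u ++ r) (l ++ v ++ r).
Proof. by move=> uv h1 h2; apply: rst_step; exists l r u v. Qed.

Lemma word_isotopic_catl p q a l w w' : width p l = Some a ->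
  word_isotopic a q w w' -> word_isotopic p q (l ++ w) (l ++ w').
Proof.
by move=> hl /(@word_isotopic_context _ _ p q l [::] _ _ hl (erefl _)); rewrite !cats0.
Qed.

Lemma word_isotopic_catr p q a r w w' : width a r = Some q ->
  word_isotopic p a w w' -> word_isotopic p q (w ++ r) (w' ++ r).
Proof. by move=> hr; apply: (@word_isotopic_context _ _ p q [::]). Qed.

(** * Half twists of three strands *)

Notation "w ~[ p , q ] w'" := (word_isotopic p q w w') (at level 70).

Definition exchange_strands (x : slice) : slice := (x.1, 1 - x.2).
Definition sigma i : slice := (Cross true, i).
Definition half_twist i := [:: sigma i; sigma (1 - i); sigma i].
Definition braid3 (w : seq slice) := all (fun x => is_cross x && (x.2 <= 1)) w.

(** The fourth strand is the arc which closes the long link. *)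
Lemma width_braid3 w : braid3 w -> width 4 w = Some 4.
Proof.
elim: w => [|[[||s] i] w IH] //= /andP[hi hw].
by rewrite (leq_trans (leq_add hi (leqnn 2))) // IH.
Qed.

Lemma half_twistC i : i <= 1 -> half_twist i ~[4, 4] half_twist 0.
Proof.
case: i => [|[|]] // _; first exact: rst_refl.
apply: rst_sym.
exact: (@word_isotopic_rule 4 4 [::] [::] _ _
          (or_intror (@reidemeister3 true true true 0 isT))).
Qed.

Lemma cancel_crossings s i : i <= 1 ->
  [:: (Cross s, i); (Cross (~~ s), i)] ~[4, 4] [::].
Proof.
move=> hi; apply: (@word_isotopic_rule 4 4 [::] [::] _ _
                     (or_intror (reidemeister2 s i))) => //.
by case: i hi => [|[|]].
Qed.

(** Conjugation by the half twist exchanges the two generators: for a positive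
    crossing this is the braid relation, and for a negative one both
    sides reduce by a move II to the same two crossings. *)
Lemma half_twist_slide w : braid3 w ->
  w ++ half_twist 0 ~[4, 4] half_twist 0 ++ map exchange_strands w.
Proof.
have one s i : i <= 1 ->
    (Cross s, i) :: half_twist 0 ~[4, 4] half_twist 0 ++ [:: (Cross s, 1 - i)].
  move=> hi.
  have hi' : 1 - i <= 1 by rewrite leq_subr.
  have ii : 1 - (1 - i) = i by rewrite subKn.
  have wi : width 4 [:: (Cross s, i)] = Some 4 by case: i hi {hi' ii} => [|[|]].
  have wi' t : width 4 [:: (Cross t, 1 - i)] = Some 4 by case: i hi {hi' ii wi} => [|[|]].
  apply: (rst_trans _ _ _ ([:: (Cross s, i)] ++ half_twist (if s then 1 - i else i))).
    apply: (word_isotopic_catl wi).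
    by apply: rst_sym; apply: half_twistC; case: ifP.
  apply: rst_sym.
  apply: (rst_trans _ _ _ (half_twist (if s then i else 1 - i) ++ [:: (Cross s, 1 - i)])).
    apply: (word_isotopic_catr (wi' _)).
    by apply: rst_sym; apply: half_twistC; case: ifP.
  case: s {wi wi'}; first by rewrite /half_twist ii; apply: rst_refl.
  have wb : width 4 [:: sigma (1 - i); sigma i] = Some 4 by case: i hi {hi' ii} => [|[|]].
  rewrite /half_twist ii.
  apply: (rst_trans _ _ _ [:: sigma (1 - i); sigma i]).
    exact: (word_isotopic_catl wb (cancel_crossings true hi')).
  by apply: rst_sym; apply: (word_isotopic_catr wb (cancel_crossings false hi)).
elim: w => [|[[||s] i] w IH] //=; first by move=> _; apply: rst_refl.
case/andP => hi hw; have hi' : 1 - i <= 1 by rewrite leq_subr.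
have hw' : width 4 (map exchange_strands w) = Some 4.
  apply: width_braid3; rewrite /braid3 all_map.
  by apply: sub_all hw => -[[||t] j] //= _; rewrite leq_subr.
apply: (rst_trans _ _ _ ([:: (Cross s, i)] ++ half_twist 0 ++ map exchange_strands w)).
  have wi : width 4 [:: (Cross s, i)] = Some 4 by case: i hi {hi'} => [|[|]].
  exact: (word_isotopic_catl wi (IH hw)).
exact: (word_isotopic_catr hw' (one s i hi)).
Qed.

(** Move I is given for a cup: a zigzag brings the crossing in front of a
    cup, where it can be removed. *)
Lemma cap_untwist i : i <= 1 -> [:: sigma i; (Cap, i)] ~[4, 2] [:: (Cap, i)].
Proof.
move=> hi; have planar l u v r (uv : planar_rule u v) :
    width 4 (l ++ u ++ r) = Some 2 -> width 4 (l ++ v ++ r) = Some 2 ->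
    l ++ u ++ r ~[4, 2] l ++ v ++ r.
  by apply: word_isotopic_rule; left.
have past h : planar_rule [:: (Cap, i); (h, i)] [:: (h, i.+2); (Cap, i)].
  by have := planar_exchange Cap h (leqnn i); rewrite addn0 addn2.
apply: (rst_trans _ _ _ [:: (Cup, i.+1); (Cap, i); sigma i; (Cap, i)]).
  apply: rst_sym; apply: (planar [::] _ _ [:: sigma i; (Cap, i)] (planar_zigzag_down i));
    by move: hi; case: (i) => [|[|]].
apply: (rst_trans _ _ _ [:: (Cup, i.+1); sigma i.+2; (Cap, i); (Cap, i)]).
  apply: (planar [:: (Cup, i.+1)] _ _ [:: (Cap, i)] (past _));
    by move: hi; case: (i) => [|[|]].
apply: (rst_trans _ _ _ [:: (Cup, i.+1); sigma i.+2; (Cap, i.+2); (Cap, i)]).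
  apply: (planar [:: (Cup, i.+1); sigma i.+2] _ _ [::] (past Cap));
    by move: hi; case: (i) => [|[|]].
apply: (rst_trans _ _ _ [:: (Cup, i.+2); (Cross false, i.+1); (Cap, i.+2); (Cap, i)]).
  apply: rst_sym; apply: (planar [::] _ _ [:: (Cap, i.+2); (Cap, i)] (planar_cup false i.+1));
    by move: hi; case: (i) => [|[|]].
apply: (rst_trans _ _ _ [:: (Cup, i.+2); sigma i.+2; (Cap, i.+1); (Cap, i)]).
  apply: (planar [:: (Cup, i.+2)] _ _ [:: (Cap, i)] (planar_cap false i.+1));
    by move: hi; case: (i) => [|[|]].
apply: (rst_trans _ _ _ [:: (Cup, i.+2); (Cap, i.+1); (Cap, i)]).
  apply: (@word_isotopic_rule 4 2 [::] [:: (Cap, i.+1); (Cap, i)] _ _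
            (or_intror (reidemeister1 true i.+2)));
    by move: hi; case: (i) => [|[|]].
apply: (planar [::] _ _ [:: (Cap, i)] (planar_zigzag_down i.+1));
  by move: hi; case: (i) => [|[|]].
Qed.

(** The last crossing untwists; after the rotation of one of the other two past
    the cap they cancel, as the remaining strand crosses the two strands of the
    cap both times over or both times under. *)
Lemma cap_half_twist i : i <= 1 ->
  half_twist 0 ++ [:: (Cap, i)] ~[4, 2] [:: (Cap, 1 - i)].
Proof.
move=> hi; have hi' : 1 - i <= 1 by rewrite leq_subr.
have wi : width 4 [:: (Cap, i)] = Some 2 by case: i hi {hi'} => [|[|]].
have wi' : width 4 [:: (Cap, 1 - i)] = Some 2 by case: i hi {hi' wi} => [|[|]].
apply: (rst_trans _ _ _ (half_twist i ++ [:: (Cap, i)])).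
  by apply: (word_isotopic_catr wi); apply: rst_sym; apply: half_twistC.
apply: (rst_trans _ _ _ ([:: sigma i; sigma (1 - i)] ++ [:: (Cap, i)])).
  have wb : width 4 [:: sigma i; sigma (1 - i)] = Some 4 by case: i hi {hi' wi wi'} => [|[|]].
  exact: (word_isotopic_catl wb (cap_untwist hi)).
apply: (rst_trans _ _ _ ([:: sigma i; (Cross false, i)] ++ [:: (Cap, 1 - i)])).
  case: i hi {hi' wi wi'} => [|[|]] // _.
    apply: rst_sym; apply: (@word_isotopic_rule 4 2 [:: sigma 0] [::] _ _
              (or_introl (planar_cap false 0))) => //.
  apply: (@word_isotopic_rule 4 2 [:: sigma 1] [::] _ _
              (or_introl (planar_cap true 0))) => //.
exact: (word_isotopic_catr wi' (cancel_crossings true hi)).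
Qed.

(** The right part of a trigonal diagram is turned over about the horizontal
    axis: a half twist is created at the cap and slides to the left through the
    braid. *)
Lemma cap_flip w i : i <= 1 -> braid3 w ->
  w ++ [:: (Cap, i)] ~[4, 2]
  half_twist 0 ++ map exchange_strands w ++ [:: (Cap, 1 - i)].
Proof.
move=> hi hw; have hi' : 1 - i <= 1 by rewrite leq_subr.
have wi' : width 4 [:: (Cap, 1 - i)] = Some 2 by case: i hi {hi'} => [|[|]].
rewrite catA; apply: rst_sym.
apply: (rst_trans _ _ _ ((w ++ half_twist 0) ++ [:: (Cap, 1 - i)])).
  by apply: (word_isotopic_catr wi'); apply: rst_sym; apply: half_twist_slide.
rewrite -catA; apply: word_isotopic_catl (width_braid3 hw) _.
by have := cap_half_twist hi'; rewrite subKn.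
Qed.

(** * Twists with alternating signs *)

(** The words for e = false and e = true differ by [exchange_strands], which
    turns a twist x on the positions 2, 3 into the twist - x on the positions
    1, 2. *)
Definition signed_twists (e : bool) (l : seq int) : seq slice :=
  twists e (if e then map (@GRing.opp int) l else l).

Lemma twists_nseq b (x : int) l : twists b (x :: l) =
  nseq `|x| (Cross ((0 < x)%R == b), ~~ b : nat) ++ twists (~~ b) l.
Proof. by case: b. Qed.

Lemma signed_twists_neg e (x : int) l : (0 < x)%R ->
  signed_twists e (map (@GRing.opp int) (x :: l)) =
  nseq `|x| (sigma (~~ e)) ++ signed_twists (~~ e) l.
Proof.
move=> x0; rewrite /signed_twists; case: e.
  by rewrite (mapK (@opprK _)) twists_nseq x0.
rewrite -[map _ (x :: l)]/(- x :: map (@GRing.opp int) l)%R twists_nseq abszN.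
by have -> : (0 < - x)%R = false by lia.
Qed.
Lemma signed_twists_pos e (x : int) l : (0 < x)%R ->
  signed_twists e (x :: l) =
  nseq `|x| (Cross false, ~~ e : nat) ++ signed_twists (~~ e) (map (@GRing.opp int) l).
Proof.
move=> x0; rewrite /signed_twists; case: e.
  rewrite -[map _ (x :: l)]/(- x :: map (@GRing.opp int) l)%R twists_nseq abszN.
  by have -> : (0 < - x)%R = false by lia.
by rewrite twists_nseq x0 (mapK (@opprK _)).
Qed.

Lemma braid3_twists b l : braid3 (twists b l).
Proof.
elim: l b => [|x l IH] b //; rewrite twists_nseq.
rewrite /braid3 all_cat [all _ (twists _ _)]IH andbT all_nseq.
by case: b; rewrite orbT.
Qed.

Lemma exchange_strands_twists b l : nonzero l ->
  map exchange_strands (twists b l) = twists (~~ b) (map (@GRing.opp int) l).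
Proof.
elim: l b => [|x l IH] b //= /andP[x0 l0].
rewrite -/(twists b (x :: l)) -/(twists (~~ b) (- x :: _)%R).
rewrite !twists_nseq map_cat map_nseq IH // abszN; congr (nseq _ _ ++ _).
have -> : (0 < - x)%R = ~~ (0 < x)%R by lia.
by case: b (0 < x)%R => [] [].
Qed.

Lemma exchange_strands_signed_twists e l : nonzero l ->
  map exchange_strands (signed_twists e l) = signed_twists (~~ e) l.
Proof.
move=> l0; rewrite /signed_twists; case: e => /=;
  rewrite exchange_strands_twists ?(mapK (@opprK _)) //.
by rewrite nonzero_opp.
Qed.

(** The case j = 0, in terms of the braid generators s1, s2 and the half twist
    D = s1 s2 s1, is s2^-1 s1^c W = D s1^-1 s2^c W' = s1 s2^(c+1) W'.  In
    general the flip of s2^-1 s2^-(j+1) s1^c W is s1 s2 s1^-(j+1) s2^c W', to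
    which the induction hypothesis applies with the generators exchanged. *)
Lemma turn_isotopic j e (c : int) l : (0 < c)%R -> nonzero l ->
  signed_twists e (Posz j.+1 :: c :: l) ++
    [:: (Cap, (odd (size l) == e) : nat)] ~[4, 2]
  sigma e :: signed_twists e (turn j ((c + 1)%R :: l)) ++
    [:: (Cap, (odd (j.+1 + size l) == e) : nat)].
Proof.
move=> c0 l0; have c1 : (0 < c + 1)%R by lia.
have hc : nonzero (c :: l) by rewrite /= gt_eqF.
have w2 (b : bool) : width 4 [:: sigma b; sigma (~~ b)] = Some 4 by case: b.
have wtail (b b' : bool) n :
    width 4 (signed_twists b n ++ [:: (Cap, b' : nat)]) = Some 2.
  by rewrite width_cat (width_braid3 (braid3_twists _ _)); case: b'.
have caps (b : bool) n : 1 - (odd n == b) = (odd n == ~~ b) :> nat.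
  by case: b; case: odd.
have odds k (b : bool) : (odd k.+1 == b) = (odd k == ~~ b).
  by rewrite /=; case: (odd k) b => [] [].
have cancel (b : bool) r : width 4 r = Some 2 ->
    half_twist 0 ++ (Cross false, b : nat) :: r ~[4, 2]
    [:: sigma b; sigma (~~ b)] ++ r.
  move=> hr; apply: (word_isotopic_catr hr
                       (w := half_twist 0 ++ [:: (Cross false, b : nat)])).
  apply: (rst_trans _ _ _ (half_twist b ++ [:: (Cross false, b : nat)])).
    apply: (word_isotopic_catr (a := 4)); first by case: b.
    by apply: rst_sym; apply: half_twistC; case: b.
  rewrite /half_twist (_ : 1 - b = ~~ b); last by case: b.
  exact: (word_isotopic_catl (w2 b) (cancel_crossings true (leq_b1 _))).
elim: j e => [|j IH] e.
  apply: (rst_trans _ _ _ _ _ (cap_flip (leq_b1 _) (braid3_twists _ _))).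
  rewrite -/(signed_twists _ _) exchange_strands_signed_twists; last exact: hc.
  rewrite signed_twists_pos // negbK signed_twists_neg // caps.
  rewrite add1n odds signed_twists_neg // (_ : `|(c + 1)%R| = `|c|.+1); last by lia.
  apply: (cancel e ((nseq _ _ ++ _) ++ _)).
  have := wtail e (odd (size l) == ~~ e) (map (@GRing.opp int) (c :: l)).
  by rewrite signed_twists_neg.
apply: (rst_trans _ _ _ _ _ (cap_flip (leq_b1 _) (braid3_twists _ _))).
rewrite -/(signed_twists _ _) exchange_strands_signed_twists; last exact: hc.
have -> : signed_twists (~~ e) (Posz j.+2 :: c :: l) =
    (Cross false, e : nat) :: signed_twists (~~ e) (Posz j.+1 :: c :: l).
  rewrite (@signed_twists_pos _ (Posz j.+2)) //.
  by rewrite (@signed_twists_pos _ (Posz j.+1)) // negbK.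
rewrite caps; apply: rst_trans (cancel e _ (wtail _ _ _)) _.
rewrite -[turn j.+1 _]/(map (@GRing.opp int) (Posz 2 :: turn j _)).
rewrite signed_twists_neg //.
rewrite addSn odds; exact: (word_isotopic_catl (w2 e) (IH (~~ e))).
Qed.

Lemma nseqSr (T : Type) k (x : T) : nseq k.+1 x = nseq k x ++ [:: x].
Proof. by rewrite -addn1 nseqD. Qed.

Lemma trigonal_word_cons k n : trigonal_word (Posz k.+1 :: n) =
  (Cup, 1) :: nseq k.+1 (sigma 0) ++ signed_twists false n ++
    [:: (Cap, (odd (size n) == false) : nat)].
Proof.
by rewrite /trigonal_word twists_nseq -!catA /=; case: (odd _).
Qed.

Lemma trigonal_isotopic i j (c : int) l : (0 < c)%R -> nonzero l ->
  isotopic (Defs.closure (trigonal (Posz i.+2 :: turn j ((c + 1)%R :: l))))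
           (Defs.closure (trigonal (Posz i.+1 :: Posz j.+1 :: c :: l))).
Proof.
move=> c0 l0; apply: word_isotopicP; apply: rst_sym.
have size_turn n : size (turn j n) = j + size n.
  by elim: j => [|k IH]; rewrite seq.size_map //= IH.
have cl n : word (Defs.closure (trigonal n)) =
    (Cup, 0) :: trigonal_word n ++ [:: (Cap, 0)] by [].
rewrite !cl !trigonal_word_cons (nseqSr i.+1) size_turn.
have wl : width 0 [:: (Cup, 0), (Cup, 1) & nseq i.+1 (sigma 0)] = Some 4.
  rewrite -[LHS]/(width 4 (nseq i.+1 (sigma 0))) width_braid3 //.
  by rewrite /braid3 all_nseq orbT.
have := turn_isotopic j false c0 l0.
rewrite (_ : odd (size l) = odd (size (Posz j.+1 :: c :: l))); last first.
  by rewrite /= negbK.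
rewrite addSnnS; set u := signed_twists false (Posz _ :: _).
set v := signed_twists false (turn _ _); move: u v => u v.
move=> /(word_isotopic_context wl (erefl : width 2 [:: (Cap, 0)] = Some 0)).
by rewrite /= -!catA.
Qed.

Lemma tame_large p : 3 < p true + p false -> tame p.
Proof. by rewrite /tame => ->. Qed.

Local Open Scope ring_scope.

Theorem theorem5p2 (m : seq int) (K : diagram 0 0)
    (hk : (3 <= size m)%N)
    (hpos : forall x : int, x \in m -> 0 < x)
    (hfirst : 2 <= head 0 m)
    (hlast : 2 <= last 0 m)
    (hK : conway_normal_form m K) :
  exists n : seq int, diagram_of_link (trigonal n) K /\ hard (trigonal n).
Proof.
have {hpos} mpos : all (fun x => 0 < x)%R m by apply/allP.
have [_ mK] := hK.
case: m hk mpos hfirst hlast {hK} mK => [|a [|b [|c l]]] //= _.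
case/and4P => a0 b0 c0 l0 a2 lst mK.
have [j bj] : exists j, b = Posz j.+1 by exists `|b|.-1%N; lia.
have [i ai] : exists i, a = Posz i.+1 by exists `|a|.-1%N; lia.
subst a b.
have lnz : nonzero l by apply: sub_all l0 => x; rewrite lt0r => /andP[].
have c1 : 0 < c + 1 by lia.
pose l' := c + 1 :: l.
have l'pos : all (fun x => 0 < x)%R l' by rewrite /= l0 c1.
have l'nz : nonzero l' by rewrite /= lnz gt_eqF.
have l'face : (3 <= face_size l')%N.
  rewrite face_size_cons //; case: (l) lst => [|y r] /=; lia.
have [tt tf] := tame_turn j l'nz (tame_faces_pos l'pos) l'face.
have tnz := turn_neq0 j l'nz.
exists (Posz i.+2 :: turn j l'); split.
  by apply: rst_trans mK; apply: trigonal_isotopic.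
split.
  have [x [y [x0 ->]]] : exists x y, 0 < x /\ turn j l' = map -%R (x :: y).
    by case: (j) => [|k]; [exists (c + 1), l | exists 2, (turn k l')].
  have [k xk] : exists k, x = Posz k.+1 by exists `|x|.-1%N; lia.
  apply: (@not_alternating _ _ _ ((Cup, 1%N) :: nseq i.+1 (sigma 0)) _ true).
  rewrite /= -/(trigonal_word _) trigonal_word_cons signed_twists_neg // xk nseqSr -catA.
  by [].
move=> D'; apply: rigid_move; apply: trigonal_rigid => //.
- rewrite /= tt andbT; apply/orP; right; apply: tame_large.
  by move: tf; rewrite /face_size; lia.
apply: tame_large; rewrite -/(face_size _) face_size_cons //.
by case: (turn j l') tf => //=; lia.
Qed.
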